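(* For every integer $n\ge 3$, the threshold $t(n,\mathcal C)$ of the monotone Oriented-cycle game on $K_n$ satisfies $t(n,\mathcal C)\le \frac{5n}{6}+1$.
   Context: The (monotone) $b$-biased Oriented-cycle game on $K_n$ ($b\ge 1$ an integer): two players, OMaker and OBreaker, alternately direct previously undirected edges of the complete graph $K_n$. OMaker moves first. In each of her moves OMaker directs exactly one previously undirected edge; in each of his moves OBreaker directs at least one and at most $b$ previously undirected edges. Each player chooses the orientation of every edge he or she directs. The game ends when all edges are directed, so that the result is a tournament on $n$ vertices. OMaker wins if the final tournament has the property $\mathcal C$ of containing a directed cycle; otherwise (the final tournament is transitive) OBreaker wins. This game is monotone in $b$ (increasing $b$ can only help OBreaker). $t(n,\mathcal C)$ denotes the threshold: OMaker has a winning strategy in the $b$-biased game when $b\le t(n,\mathcal C)$ and OBreaker has a winning strategy when $b>t(n,\mathcal C)$ (with $t(n,\mathcal C)=0$ if OMaker wins for no $b\ge1$). *)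

(* Defs.v *)
From mathcomp Require Import all_boot all_order all_algebra.
From mathcomp Require Import boolp.

Set Implicit Arguments.
Unset Strict Implicit.
Unset Printing Implicit Defensive.

(* A position on K_n is the set of arcs directed so far. *)
Definition position (n : nat) : finType := {set 'I_n * 'I_n}.

(* Taking u = v shows that an oriented position contains no loop. *)
Definition oriented n (D : position n) : bool :=
  [forall u, forall v, ((u, v) \in D) ==> ((v, u) \notin D)].

Definition tournament n (D : position n) : bool :=
  oriented D &&
  [forall u, forall v, (u != v) ==> (((u, v) \in D) || ((v, u) \in D))].

Definition arc n (D : position n) : rel 'I_n := fun u v => (u, v) \in D.

(* In an oriented position such a cycle automatically has length at least 3. *)
Definition has_dicycle n (D : position n) : Prop :=
  exists c : seq 'I_n, c <> [::] /\ ucycle (arc D) c.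

Inductive player := OMaker | OBreaker.

Definition wins n (pl : player) (D : position n) : Prop :=
  match pl with
  | OMaker => has_dicycle D
  | OBreaker => ~ has_dicycle D
  end.

(* Since [D'] is oriented and contains [D], the arcs of [D' :\: D] are on
   distinct edges that are undirected in [D]. *)
Definition move n (k : nat) (D D' : position n) : bool :=
  [&& oriented D', D \subset D' & 0 < #|D' :\: D| <= k].

Definition move_bound (b : nat) (pl : player) : nat :=
  match pl with OMaker => 1 | OBreaker => b end.

(* A play is recorded as the sequence of positions reached after each move, so
   the empty sequence is the start of the game. *)
Definition turn n (p : seq (position n)) : player :=
  if odd (size p) then OBreaker else OMaker.

Definition current n (p : seq (position n)) : position n := last set0 p.

Definition strategy (n : nat) := seq (position n) -> position n.

Inductive play_with n (b : nat) (pl : player) (s : strategy n) :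
    seq (position n) -> Prop :=
| PlayStart : play_with b pl s [::]
| PlayStep p D' of play_with b pl s p
    & move (move_bound b (turn p)) (current p) D'
    & (turn p = pl -> D' = s p) :
    play_with b pl s (rcons p D').

(* The first conjunct makes [s] prescribe legal moves: otherwise a strategy
   leaving the rules would win vacuously. *)
Definition winning_strategy n (b : nat) (pl : player) (s : strategy n) : Prop :=
  (forall p, play_with b pl s p -> turn p = pl -> ~~ tournament (current p) ->
     move (move_bound b pl) (current p) (s p)) /\
  (forall p, play_with b pl s p -> tournament (current p) ->
     wins pl (current p)).

Definition has_winning_strategy (n b : nat) (pl : player) : Prop :=
  exists s : strategy n, winning_strategy b pl s.

Definition is_threshold (n t : nat) : Prop :=
  forall b, 1 <= b ->
    (b <= t -> has_winning_strategy n b OMaker) /\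
    (t < b -> has_winning_strategy n b OBreaker).

(* The rest shows that [is_threshold n] holds for exactly one number. *)

Lemma move_card n k (D D' : position n) : move k D D' -> #|D| < #|D'|.
Proof.
case/and3P=> _ sDD' /andP[h _]; rewrite -(cardsID D D').
by rewrite (setIidPr sDD') -[X in X < _]addn0 ltn_add2l.
Qed.

Lemma move_not_tournament n k (D D' : position n) :
  move k D D' -> ~~ tournament D.
Proof.
case/and3P=> /forallP O /subsetP S /andP[/card_gt0P[[u v]] + _].
rewrite inE => /andP[nD inD']; apply/negP => /andP[_ /forallP/(_ u)/forallP/(_ v)].
have /forallP/(_ v)/implyP/(_ inD') nvu := O u.
rewrite (negbTE nD) /=; case: eqP => [uv|_ /= /S h]; last by rewrite h in nvu.
by rewrite uv in inD' nvu; rewrite inD' in nvu.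
Qed.

Lemma play_size n b pl (s : strategy n) p :
  play_with b pl s p -> size p <= #|current p|.
Proof.
elim=> // q D' _ IH m _; rewrite size_rcons /current last_rcons.
exact: leq_ltn_trans IH (move_card m).
Qed.

Lemma play_size_max n b pl (s : strategy n) p :
  play_with b pl s p -> size p <= n * n.
Proof.
move/play_size/leq_trans; apply.
by apply: leq_trans (max_card _) _; rewrite card_prod card_ord.
Qed.

Definition opponent pl := match pl with OMaker => OBreaker | OBreaker => OMaker end.

Definition mine pl t :=
  match pl, t with OMaker, OMaker | OBreaker, OBreaker => true | _, _ => false end.

Lemma mineP pl t : reflect (t = pl) (mine pl t).
Proof. by case: pl; case: t; constructor. Qed.

Fixpoint value n b pl k t (D : position n) : bool :=
  match k with
  | 0 => `[< wins pl D >]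
  | k'.+1 =>
    if tournament D then `[< wins pl D >]
    else if mine pl t then
      [exists D', move (move_bound b t) D D' && value b pl k' (opponent t) D']
    else
      [forall D', move (move_bound b t) D D' ==> value b pl k' (opponent t) D']
  end.

Lemma value_opponent n b pl k t (D : position n) :
  value b (opponent pl) k t D = ~~ value b pl k t D.
Proof.
have H (E : position n) : `[< wins (opponent pl) E >] = ~~ `[< wins pl E >].
  by case: pl => /=; rewrite asbool_neg ?negbK.
elim: k t D => [|k IH] t D //=; case: ifP => // _.
have -> : mine (opponent pl) t = ~~ mine pl t by case: pl {IH H}; case: t.
case: (mine pl t) => /=.
  rewrite negb_exists; apply: eq_forallb => D'.
  by rewrite IH negb_and implybE.
rewrite negb_forall; apply: eq_existsb => D'.
by rewrite IH negb_imply.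
Qed.

Lemma turn_rcons n (p : seq (position n)) D : turn (rcons p D) = opponent (turn p).
Proof. by rewrite /turn size_rcons /=; case: odd. Qed.

Lemma value_win n b pl :
  value b pl (n * n).+1 OMaker (set0 : position n) ->
  has_winning_strategy n b pl.
Proof.
move=> v0; pose N := (n * n).+1.
pose good p (D' : position n) := move (move_bound b (turn p)) (current p) D' &&
  value b pl (N - (size p).+1) (opponent (turn p)) D'.
pose s : strategy n := fun p => odflt set0 [pick D' | good p D'].
have fuel p : play_with b pl s p -> N - size p = (N - (size p).+1).+1.
  by move/play_size_max => le; rewrite subnSK.
have ok p : turn p = pl -> play_with b pl s p -> ~~ tournament (current p) ->
    value b pl (N - size p) (turn p) (current p) -> good p (s p).
  move=> tp pp nt; rewrite (fuel p pp) /= (negbTE nt).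
  have -> : mine pl (turn p) by apply/mineP.
  by case/existsP=> D' gD'; rewrite /s; case: pickP => //= /(_ D'); rewrite /good gD'.
have inv p : play_with b pl s p -> value b pl (N - size p) (turn p) (current p).
  elim=> [|q D' pq IH m e]; first by rewrite subn0.
  rewrite size_rcons turn_rcons /current last_rcons.
  have nt := move_not_tournament m.
  case: (mineP pl (turn q)) => [tq|ntq].
    by rewrite (e tq); case/andP: (ok q tq pq nt IH).
  move: IH; rewrite (fuel q pq) /= (negbTE nt).
  case: mineP => // _ /forallP/(_ D')/implyP; exact.
exists s; split=> [p pp tp nt|p pp T].
  by case/andP: (ok p tp pp nt (inv p pp)); rewrite tp.
by have := inv p pp; rewrite (fuel p pp) /= T => /asboolP.
Qed.

Lemma determined n b :
  has_winning_strategy n b OMaker \/ has_winning_strategy n b OBreaker.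
Proof.
case v: (value b OMaker (n * n).+1 OMaker (set0 : position n)).
  by left; apply: value_win.
by right; apply: value_win; rewrite (value_opponent _ OMaker) v.
Qed.

Lemma not_both_win n b :
  has_winning_strategy n b OMaker -> ~ has_winning_strategy n b OBreaker.
Proof.
move=> [s [sl sw]] [r [rl rw]].
have H k : exists p, [/\ play_with b OMaker s p, play_with b OBreaker r p
    & tournament (current p) || (k <= size p)].
  elim: k => [|k [p [ps pr /orP[T|le]]]].
  - by exists [::]; split; [exact: PlayStart | exact: PlayStart | rewrite orbT].
  - by exists p; split; rewrite ?T.
  case T: (tournament (current p)); first by exists p; split; rewrite ?T.
  move/negbT in T; case tp: (turn p).
  - exists (rcons p (s p)); have m := sl p ps tp T.
    by split; [apply: PlayStep | apply: PlayStep | rewrite size_rcons ltnS le orbT];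
      rewrite ?tp.
  - exists (rcons p (r p)); have m := rl p pr tp T.
    by split; [apply: PlayStep | apply: PlayStep | rewrite size_rcons ltnS le orbT];
      rewrite ?tp.
have [p [ps pr /orP[T|]]] := H (n * n).+1; first exact: rw pr T (sw p ps T).
by rewrite ltnNge (play_size_max ps).
Qed.

Lemma maker_antimonotone n b b' : b <= b' ->
  has_winning_strategy n b' OMaker -> has_winning_strategy n b OMaker.
Proof.
move=> le [s [sl sw]]; exists s.
have H p : play_with b OMaker s p -> play_with b' OMaker s p.
  elim=> [|q D' _ IH m e]; first exact: PlayStart.
  apply: PlayStep => //; move: m; case: (turn q) => //=.
  by case/and3P=> o S /andP[h h']; rewrite /move o S h (leq_trans h' le).
by split=> p /H; [apply: sl | apply: sw].
Qed.

Lemma breaker_large n b : n * n <= b -> has_winning_strategy n b OBreaker.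
Proof.
move=> le.
(* Answer an arc (u, v) by the transitive tournament starting at u. *)
pose rk (u x : 'I_n) := if x == u then 0 else x.+1.
pose full u : position n := [set a : 'I_n * 'I_n | rk u a.1 < rk u a.2].
pose s : strategy n := fun p =>
  if [pick a in current p] is Some a then full a.1 else set0.
have fullO u : oriented (full u).
  apply/forallP=> x; apply/forallP=> y; apply/implyP.
  by rewrite !inE /= => h; rewrite -leqNgt ltnW.
have rkI u x y : x != y -> (rk u x < rk u y) || (rk u y < rk u x).
  rewrite -neq_ltn /rk; case: (x =P u) => [->|_]; case: (y =P u) => [->|_] //.
  by rewrite eqxx.
have fullT u : tournament (full u).
  apply/andP; split=> //; apply/forallP=> x; apply/forallP=> y; apply/implyP.
  by rewrite !inE; exact: rkI.
have fullA u : ~ has_dicycle (full u).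
  case=> c [c0 /andP[cy _]]; case: c c0 cy => [//|x c] _ cy.
  have tr : transitive (arc (full u)).
    by move=> y x' z; rewrite /arc !inE /=; exact: ltn_trans.
  have /allP/(_ x) := order_path_min tr cy.
  by rewrite mem_rcons mem_head /arc inE ltnn => /(_ isT).
have one k (D : position n) : oriented D -> move k set0 D -> k = 1 ->
    exists u v, [/\ D = [set (u, v)] & u != v].
  move=> o /and3P[_ _]; rewrite setD0 => /[swap] ->; rewrite -eqn_leq eq_sym.
  case/cards1P => -[u v] e; exists u, v; split=> //.
  apply/eqP=> uv; move: o; rewrite e uv => /forallP/(_ v)/forallP/(_ v).
  by rewrite !inE eqxx.
have sfull u v : u != v -> s [:: [set (u, v)]] = full u.
  move=> _; rewrite /s /current /=; case: pickP => [a|/(_ (u, v))].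
    by rewrite inE => /eqP->.
  by rewrite inE eqxx.
have sub1 u v : u != v -> [set (u, v)] \subset full u.
  by move=> uv; rewrite sub1set inE /= /rk eqxx eq_sym (negbTE uv).
have shape p : play_with b OBreaker s p ->
  [\/ p = [::], exists u v, [/\ p = [:: [set (u, v)]] & u != v]
    | exists u D, p = [:: D; full u]].
  elim=> [|q D' pq IH m e]; first by constructor 1.
  case: IH => [q0|[u [v [qu uv]]]|[u [D qu]]].
  - constructor 2; subst q; have /and3P[o _ _] := m.
    have [u [v [-> uv]]] := one _ _ o m erefl.
    by exists u, v.
  - constructor 3; subst q; rewrite e // sfull //.
    by exists u, [set (u, v)].
  - by subst q; have := move_not_tournament m; rewrite /current /= fullT.
exists s; split=> p /shape [->|[u [v [-> uv]]]|[u [D ->]]] //=.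
- rewrite sfull // => _ nt; rewrite /move fullO /=.
  have S := sub1 _ _ uv.
  rewrite /current /= S /=; apply/andP; split.
    rewrite card_gt0 setD_eq0; apply: contra nt => S'.
    suff -> : current [:: [set (u, v)]] = full u by [].
    by apply/eqP; rewrite eqEsubset S S'.
  apply: leq_trans le; apply: leq_trans (max_card _) _.
  by rewrite card_prod card_ord.
- by move=> _ [c [c0 /andP[cy _]]]; case: c c0 cy => [|x [|y c]] //= _;
    rewrite /arc inE.
- move=> _ [c [c0 /andP[cy un]]]; apply: (fullA u); exists c; split=> //.
  rewrite /ucycle un andbT; apply: sub_cycle cy => x y.
  by rewrite /arc /current /= inE => /eqP[-> ->]; have := sub1 _ _ uv; rewrite sub1set.
- by move=> _; exact: fullA.
Qed.

Lemma threshold_exists_unique n : exists! t, is_threshold n t.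
Proof.
pose won b := (0 < b) && `[< has_winning_strategy n b OMaker >].
pose P t := (t == 0) || won t.
have bound t : P t -> t <= n * n.
  case/orP=> [/eqP-> //|/andP[_ /asboolP M]].
  by rewrite leqNgt; apply/negP => /ltnW/breaker_large; exact: not_both_win.
have ex : exists t, P t by exists 0.
case: (ex_maxnP ex bound) => t Pt max; exists t; split.
  move=> b b0; split=> [le|lt].
    case/orP: Pt => [/eqP t0|/andP[_ /asboolP]]; last exact: maker_antimonotone.
    by move: le; rewrite t0 leqNgt b0.
  case: (determined n b) => // M; move: lt; rewrite ltnNge max //.
  by rewrite /P /won b0 orbC; apply/orP; left; apply/asboolP.
move=> t' T'; apply/eqP; rewrite eqn_leq; apply/andP; split; rewrite leqNgt.
  apply/negP => lt; have t0 := leq_ltn_trans (leq0n _) lt.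
  case/orP: Pt => [/eqP e|/andP[_ /asboolP M]]; first by rewrite e in t0.
  exact: (not_both_win M ((T' t t0).2 lt)).
apply/negP => lt; have t0 := leq_ltn_trans (leq0n _) lt.
have M := (T' t' t0).1 (leqnn _).
suff /max : P t' by rewrite leqNgt lt.
by rewrite /P /won t0 orbC; apply/orP; left; apply/asboolP.
Qed.

Lemma threshold_exists n : exists t, is_threshold n t.
Proof. by case: (threshold_exists_unique n) => t [T _]; exists t. Qed.

Definition threshold (n : nat) : nat := sval (cid (threshold_exists n)).

Lemma thresholdP n : is_threshold n (threshold n).
Proof. exact: svalP (cid (threshold_exists n)). Qed.

(* Main.v *)
(* OBreaker keeps the position a strict partial order, so that OMaker's next arc
   never closes a cycle. The order contains all arcs of A x B for disjoint sets
   A and B, every arc starts in A or ends in B, and the orders induced off B and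
   off A are interval orders, of ranks r and s. An OMaker arc avoiding B is
   absorbed by moving a vertex into A and inserting the arc into the interval
   order off B, at the price of #|B| + r + 1 arcs; arcs avoiding A are treated
   dually. Throughout #|A| = r + d and #|B| = s + d. While 5 d + 3 <= b the
   budget also pays for one further vertex on each side, so that d = r + s
   grows; afterwards d is about b / 5, and 6 b >= 5 n + 7 makes the remaining
   moves affordable until A and B exhaust the vertices. From then on inserting
   an arc inside A costs less than #|A| <= b + 1. *)

Require Import Defs.
From mathcomp Require Import all_boot all_order all_algebra.
From mathcomp Require Import boolp zify lra.

Set Implicit Arguments.
Unset Strict Implicit.
Unset Printing Implicit Defensive.

(** * Strict orders around a complete bipartite part, and their reversal *)

Section BicliqueOrder.

Variable T : finType.
Implicit Types (D : {set T * T}) (A B : {set T}) (x y z u v w c : T).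

Definition preds D v : {set T} := [set u | (u, v) \in D].

Lemma in_preds D v u : (u \in preds D v) = ((u, v) \in D).
Proof. by rewrite inE. Qed.

(** Reversal swaps [(A, r)] with [(B, s)], so arcs avoiding [A] reduce to arcs avoiding [B]. *)
Definition flip D : {set T * T} := [set a | (a.2, a.1) \in D].

(* Nested predecessor sets make the order off B an interval order. The bound r
   is on the number of arcs needed to cut that order at any given place: tails
   from below the cut to a new head, and from a new tail to the heads above. *)
Definition nested_preds D B r : Prop :=
  (forall z z', z \notin B -> z' \notin B ->
     (preds D z \subset preds D z') || (preds D z' \subset preds D z)) /\
  (forall z, z \notin B ->
     #|preds D z| + #|[set w | (w \notin B) && (preds D z \proper preds D w)]|
       <= r).

(** By [bo_arc] the predecessors of a vertex off [B] lie in [A], hence off [B], so [bo_preds] speaks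
    of the order induced off [B] alone. [bo_succs] is its dual. *)
Record biclique_order D A B (r s : nat) : Prop := BicliqueOrder {
  bo_irr : forall x, (x, x) \notin D;
  bo_trans : forall y x z, (x, y) \in D -> (y, z) \in D -> (x, z) \in D;
  bo_disj : forall x, x \in A -> x \notin B;
  bo_full : forall x y, x \in A -> y \in B -> (x, y) \in D;
  bo_arc : forall x y, (x, y) \in D -> (x \in A) || (y \in B);
  bo_preds : nested_preds D B r;
  bo_succs : nested_preds (flip D) A s }.

Lemma in_flip D x y : ((x, y) \in flip D) = ((y, x) \in D).
Proof. by rewrite inE. Qed.

Lemma flipK : involutive flip.
Proof. by move=> D; apply/setP => -[x y]; rewrite !in_flip. Qed.

Lemma card_flip D : #|flip D| = #|D|.
Proof.
have inj : injective (fun a : T * T => (a.2, a.1)) by move=> [? ?] [? ?] [-> ->].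
rewrite -(card_imset (flip D) inj); apply: eq_card => -[x y].
apply/imsetP/idP => [[[u v]] + [-> ->]|xyD]; first by rewrite in_flip.
by exists (y, x); rewrite ?in_flip.
Qed.

Lemma flipS D D' : D \subset D' -> flip D \subset flip D'.
Proof. by move/subsetP=> S; apply/subsetP => -[x y]; rewrite !in_flip; apply: S. Qed.

Lemma flipD D D' : flip (D' :\: D) = flip D' :\: flip D.
Proof. by apply/setP => -[x y]; rewrite !inE. Qed.

Lemma biclique_order_flip D A B r s :
  biclique_order D A B r s -> biclique_order (flip D) B A s r.
Proof.
case=> irr tr dj full arc hp hs; split=> //.
- by move=> x; rewrite in_flip.
- by move=> y x z; rewrite !in_flip => h1 h2; apply: tr h2 h1.
- by move=> x xB; apply/negP => /dj; rewrite xB.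
- by move=> x y xB yA; rewrite in_flip full.
- by move=> x y; rewrite in_flip => /arc; rewrite orbC.
- by rewrite flipK.
Qed.

Lemma biclique_order0 : biclique_order set0 set0 set0 0 0.
Proof.
have p0 z : preds set0 z = set0 by apply/setP => u; rewrite !inE.
have f0 : flip set0 = set0 by apply/setP => u; rewrite !inE.
have h0 : nested_preds set0 set0 0.
  split=> [z z'|z] _; first by rewrite !p0 sub0set.
  rewrite p0 cards0 add0n leqn0 cards_eq0; apply/eqP/setP => w.
  by rewrite !inE p0 properxx.
by split; rewrite ?f0 //; 
  first [by move=> x; rewrite inE | by move=> x y; rewrite inE
        | by move=> x y z; rewrite inE].
Qed.

Lemma biclique_order_setT : biclique_order set0 setT set0 0 0.
Proof.
case: biclique_order0 => irr tr dj full arc hp hs; split=> // [x|x y|x y|].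
- by rewrite !inE.
- by rewrite !inE.
- by rewrite !inE.
- by case: hs => h1 h2; split=> z; [move=> z' |]; rewrite inE.
Qed.

(** * Enlarging [A] and inserting an arc *)

(** Transitivity survives because an old arc into [c] starts in [A], which already dominates [B],
    and an old arc leaving [B] ends in [B]. Predecessor sets off [B] and successor sets off the new
    [A] do not change. *)
Lemma biclique_order_widen D A B r s c :
  biclique_order D A B r s -> c \notin B ->
  let D' := D :|: setX [set c] B in
  biclique_order D' (c |: A) B r s /\ #|D' :\: D| <= #|B|.
Proof.
case=> irr tr dj full arc hp hs cB D'.
have inD' x y : ((x, y) \in D') = ((x, y) \in D) || ((x == c) && (y \in B)).
  by rewrite !inE.
have predE z : z \notin B -> preds D' z = preds D z.
  by move=> zB; apply/setP => u; rewrite !inE (negbTE zB) andbF orbF.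
have succE z : z \notin c |: A -> preds (flip D') z = preds (flip D) z.
  rewrite in_setU1 negb_or => /andP[/negbTE zc _].
  by apply/setP => u; rewrite !inE zc orbF.
have subA z : z \notin c |: A -> z \notin A.
  by rewrite in_setU1 negb_or => /andP[].
split; last first.
  apply: leq_trans (_ : #|setX [set c] B| <= _); last by rewrite cardsX cards1 mul1n.
  by apply: subset_leq_card; rewrite setDUl setDv set0U subsetDl.
split.
- by move=> x; rewrite inD' negb_or irr; case: eqP => [->|].
- move=> y x z; rewrite !inD'.
  case/orP=> [xy|/andP[/eqP-> yB]]; case/orP=> [yz|/andP[/eqP yc zB]].
  + by rewrite (tr y).
  + move: (arc _ _ xy); rewrite yc (negbTE cB) orbF => xA.
    by rewrite full.
  + move: (arc _ _ yz); case yA : (y \in A); first by rewrite (negbTE (dj _ yA)) in yB.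
    by move=> /= ->; rewrite eqxx orbT.
  + by rewrite zB eqxx orbT.
- by move=> x /setU1P[->|/dj].
- by move=> x y /setU1P[->|xA] yB; rewrite inD' ?eqxx ?yB ?orbT // full.
- move=> x y; rewrite inD' in_setU1 => /orP[/arc/orP[->|->]|/andP[-> _]];
    by rewrite ?orbT.
- case: hp => h1 h2; split=> [z z' zB z'B|z zB]; first by rewrite !predE ?h1.
  rewrite predE //; move: (h2 z zB); congr (_ + _ <= _); apply: eq_card => w.
  by rewrite !inE; case: (boolP (w \in B)) => //= wB; rewrite predE.
- case: hs => h1 h2; split=> [z z' zA z'A|z zA].
    by rewrite !succE ?h1 ?subA.
  rewrite succE //; apply: leq_trans (h2 z (subA _ zA)); rewrite leq_add2l.
  apply: subset_leq_card; apply/subsetP => w; rewrite inE => /andP[wA].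
  by rewrite succE // => pr; rewrite inE subA.
Qed.

(** The set [x |: P] enters the chain of predecessor sets just above [P], as the new set of [y], and
    all sets above [P] receive [x]. The cost bound [r.+1] serves until [A] and [B] cover all
    vertices, the bound [#|~: B|] from then on. *)
Lemma biclique_order_insert D A B r s x y :
  biclique_order D A B r s -> x \in A -> y \notin B -> x != y ->
  (x, y) \notin D -> (y, x) \notin D ->
  exists D', [/\ biclique_order D' A B r.+1 s, D \subset D', (x, y) \in D',
    #|D' :\: D| <= r.+1 & #|D' :\: D| < #|~: B|].
Proof.
case=> irr tr dj full arc [h1 h2] hs xA yB xy xyD yxD.
have xB := dj _ xA.
(* The cut is at P, the larger of the predecessor sets of x and y. *)
pose P := preds D x :|: preds D y.
pose W := [set w | (w \notin B) && (P \proper preds D w)].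
pose D' := D :|: (setX (x |: preds D x) [set y] :|: setX [set x] W).
have PE : exists2 z, z \notin B & P = preds D z.
  case/orP: (h1 x y xB yB) => h; [exists y|exists x] => //.
    exact/setUidPr.
  exact/setUidPl.
have inP u : (u \in P) = ((u, x) \in D) || ((u, y) \in D) by rewrite !inE.
have inW w : (w \in W) = (w \notin B) && (P \proper preds D w) by rewrite inE.
have inD' u v : ((u, v) \in D') = [|| (u, v) \in D,
    (v == y) && ((u == x) || ((u, x) \in D)) | (u == x) && (v \in W)].
  by rewrite in_setU in_setU !in_setX !in_set1 in_setU1 inE [X in _ || (X || _)]andbC.
have xP : x \notin P by rewrite inP negb_or irr.
have yP : y \notin P by rewrite inP negb_or yxD irr.
have costP : #|D' :\: D| <= (#|P| + #|W|).+1.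
  have -> : (#|P| + #|W|).+1 = #|setX (x |: P) [set y]| + #|setX [set x] W|.
    by rewrite !cardsX !cards1 cardsU1 xP muln1 mul1n.
  apply: leq_trans (leq_card_setU _ _).
  apply: subset_leq_card; apply/subsetP => -[u v].
  rewrite !inE => /andP[/negbTE-> /=].
  by case/orP=> [/andP[/orP[->|->] ->]|->]; rewrite ?orbT.
have subD : D \subset D' by apply: subsetUl.
have sPx : preds D x \subset P by apply: subsetUl.
have sPy : preds D y \subset P by apply: subsetUr.
have leW : #|P| + #|W| <= r by case: PE => p pB PE; rewrite /W PE; apply: h2.
clearbody D' W P.
have prT u v : (u, v) \in D -> preds D u \subset preds D v.
  by move=> uv; apply/subsetP => t; rewrite !inE => tu; apply: tr uv.
(* By nestedness, a head off [B] with a predecessor outside [P] lies above the cut. This handles a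
   new arc into [y] followed by an old arc out of [y]. *)
have notW u v : u \notin B -> (u, v) \in D -> v \notin B -> u \notin P -> v \in W.
  case: PE => z zB PE uB uv vB; rewrite inW vB PE => uP; apply/properP.
  have uv' : u \in preds D v by rewrite inE.
  split; last by exists u.
  case/orP: (h1 z v zB vB) => // /subsetP/(_ u uv') h; by rewrite h in uP.
have PW u : u \in P -> u \notin W.
  move=> uP; rewrite inW negb_and; apply/orP; right.
  have S : preds D u \subset P.
    move: uP; rewrite inP => /orP[]/prT S; apply: subset_trans S _.
      exact: sPx.
    exact: sPy.
  by apply/negP => /proper_sub_trans/(_ S); rewrite properxx.
have xW : x \notin W.
  rewrite inW xB /=; apply/negP => /proper_sub_trans/(_ sPx).
  by rewrite properxx.
have yW : y \notin W.
  rewrite inW yB /=; apply/negP => /proper_sub_trans/(_ sPy).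
  by rewrite properxx.
exists D'; split.
- have notWP z : z \notin B -> z \notin W -> preds D z \subset P.
    move=> zB; rewrite inW zB; case: PE => p pB -> /=.
    by rewrite properE; case/orP: (h1 z p zB pB) => -> //; rewrite negbK.
  have WP z : z \in W -> P \subset preds D z by rewrite inW => /andP[_ /proper_sub].
  have WB z : z \in W -> z \notin B by rewrite inW => /andP[].
  have predy : preds D' y = x |: P.
    apply/setP => u; rewrite in_preds inD' in_setU1 inP eqxx (negbTE yW) andbF orbF /=.
    by rewrite orbC -orbA.
  have predW z : z \in W -> preds D' z = x |: preds D z.
    move=> zW; apply/setP => u; rewrite in_preds inD' in_setU1 zW andbT in_preds.
    by rewrite (negbTE (memPn yW z zW)) /= orbC.
  have predN z : z != y -> z \notin W -> preds D' z = preds D z.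
    move=> zy zW; apply/setP => u; rewrite !in_preds inD' (negbTE zy) (negbTE zW).
    by rewrite /= andbF !orbF.
  (* The new chain: old sets inside [P], then [x |: P], then the sets of [W] enlarged by [x]. *)
  have predP z : z \notin B ->
    [\/ z = y /\ preds D' z = x |: P,
        z \in W /\ preds D' z = x |: preds D z
      | [/\ preds D' z = preds D z & preds D z \subset P]].
    move=> zB; case: (eqVneq z y) => [->|zy]; first by constructor 1.
    case: (boolP (z \in W)) => zW; first by constructor 2; split=> //; apply: predW.
    by constructor 3; split; [apply: predN | apply: notWP].
  split=> //.
  + by move=> u; rewrite inD' (negbTE (irr u)) /=; apply/negP;
      case/orP=> /andP[/eqP->]; rewrite ?(negbTE xW) // eq_sym (negbTE xy) (negbTE yxD).
  + have inA u : (u, x) \in D -> u \in A by move/arc; rewrite (negbTE xB) orbF.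
    have predxW u z : (u, x) \in D -> z \in W -> (u, z) \in D.
      by move=> ux /WP/subsetP/(_ u); rewrite inP ux inE; apply.
    move=> v u z; rewrite (inD' u v) (inD' v z).
    move=> uv /or3P[vz|/andP[/eqP-> /orP[/eqP vx|vx]]|/andP[/eqP vx zW]]; move: uv.
    * case/or3P=> [uv|/andP[/eqP vy]|/andP[/eqP-> vW]]; first by rewrite inD' (tr v).
      - rewrite vy in vz; case: (boolP (z \in B)) => zB.
          by case/orP=> [/eqP->|/inA uA]; rewrite inD' full.
        have zW := notW _ _ yB vz zB yP.
        case/orP=> [/eqP->|ux]; first by rewrite inD' zW eqxx !orbT.
        by rewrite inD' (predxW u z ux zW).
      - case: (boolP (z \in B)) => zB; first by rewrite inD' full.
        rewrite inD' inW zB eqxx /=; move: vW; rewrite inW => /andP[_ pr].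
        by rewrite (proper_sub_trans pr (prT _ _ vz)) !orbT.
    * rewrite vx; case/or3P=> [ux|/andP[xy' _]|/andP[_]]; last by rewrite (negbTE xW).
        by rewrite inD' ux eqxx !orbT.
      by rewrite xy' in xy.
    * case/or3P=> [uv|/andP[/eqP vy]|/andP[_ vW]].
      - by rewrite inD' (tr v u x uv vx) eqxx !orbT.
      - by rewrite vy (negbTE yxD) in vx.
      - have /PW : v \in P by rewrite inP vx.
        by rewrite vW.
    * rewrite vx; case/or3P=> [ux|/andP[xy' _]|/andP[_]]; last by rewrite (negbTE xW).
        by rewrite inD' (predxW u z ux zW).
      by rewrite xy' in xy.
  + by move=> u v uA vB; rewrite inD' full.
  + move=> u v; rewrite inD' => /or3P[/arc //|/andP[_ /orP[/eqP->|]]|/andP[/eqP->]].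
    * by rewrite xA.
    * by move/arc; rewrite (negbTE xB) orbF => ->.
    * by rewrite xA.
  + split=> [z z' zB z'B|z zB].
      case: (predP z zB) => [[_ ->]|[zW ->]|[-> zP]];
      case: (predP z' z'B) => [[_ ->]|[z'W ->]|[-> z'P]].
      * by rewrite subxx.
      * by rewrite setUS ?WP.
      * by rewrite (subset_trans z'P (subsetUr _ _)) orbT.
      * by rewrite (setUS _ (WP _ zW)) orbT.
      * by case/orP: (h1 z z' zB z'B) => h; rewrite (setUS _ h) ?orbT.
      * by rewrite (subset_trans z'P (subset_trans (WP _ zW) (subsetUr _ _))) orbT.
      * by rewrite (subset_trans zP (subsetUr _ _)).
      * by rewrite (subset_trans zP (subset_trans (WP _ z'W) (subsetUr _ _))).
      * exact: h1.
    have properW v w : v \notin B -> w \notin B ->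
        ~~ (preds D w \subset preds D v) -> preds D v \proper preds D w.
      by move=> vB wB h; rewrite properE h andbT;
        move: (h1 v w vB wB); rewrite (negbTE h) orbF.
    (* Compare with the old cut at [z], or at [P] when [z = y]. If [z] is [y] or in [W], only [x] is
       new below; otherwise only [y] can be new above. *)
    case: (predP z zB) => [[_ ->]|[zW ->]|[-> zP]].
    * apply: (@leq_trans (#|P|.+1 + #|W|)); last first.
        by rewrite addSn ltnS; exact: leW.
      rewrite cardsU1 xP leq_add2l; apply: subset_leq_card; apply/subsetP => w.
      rewrite inE => /andP[wB]; case: (predP w wB) => [[_ ->]|[wW _]|[-> wP]] //.
        by rewrite properxx.
      move=> pr; have := sub_proper_trans (subsetUr _ _) (proper_sub_trans pr wP).
      by rewrite properxx.
    * apply: (@leq_trans (#|preds D z|.+1 + #|[set w | (w \notin B) &&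
        (preds D z \proper preds D w)]|)); last by rewrite addSn ltnS h2.
      rewrite cardsU1; apply: leq_add; first by rewrite -add1n leq_add2r leq_b1.
      apply: subset_leq_card; apply/subsetP => w; rewrite !in_set.
      move=> /andP[wB]; rewrite wB /=.
      case: (predP w wB) => [[_ ->]|[wW ->]|[-> wP]] pr.
      - by have := proper_sub_trans pr (setUS _ (WP _ zW)); rewrite properxx.
      - apply: properW => //; apply/negP => /(setUS [set x])/(proper_sub_trans pr).
        by rewrite properxx.
      - have := sub_proper_trans (subsetUr _ _) (proper_sub_trans pr wP).
        by move/proper_sub_trans/(_ (WP _ zW)); rewrite properxx.
    * apply: (@leq_trans (#|preds D z| + #|y |: [set w | (w \notin B) &&
        (preds D z \proper preds D w)]|)); last first.
        rewrite cardsU1 addnCA -add1n; apply: leq_add (leq_b1 _) (h2 z zB).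
      rewrite leq_add2l; apply: subset_leq_card; apply/subsetP => w.
      rewrite inE => /andP[wB]; rewrite in_setU1 inE wB /=.
      case: (predP w wB) => [[-> _]|[wW _] _|[-> //]]; first by rewrite eqxx.
        apply/orP; right; apply: sub_proper_trans zP _.
        by move: wW; rewrite inW => /andP[].
      by move=> _ ->; rewrite orbT.
  (* All new arcs start in [A]. *)
  + have succN z : z \notin A -> preds (flip D') z = preds (flip D) z.
      move=> zA; apply/setP => u; rewrite !in_preds !in_flip inD'.
      have -> : (z == x) = false by apply/eqP => zx; rewrite zx xA in zA.
      case zx: ((z, x) \in D); last by rewrite andbF !orbF.
      by have := arc _ _ zx; rewrite (negbTE zA) (negbTE xB).
    case: hs => k1 k2; split=> [z z' zA z'A|z zA]; first by rewrite !succN ?k1.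
    rewrite succN //; move: (k2 z zA); congr (_ + _ <= _); apply: eq_card => w.
    by rewrite !in_set; case: (boolP (w \in A)) => //= wA; rewrite succN.
- by [].
- by rewrite inD' !eqxx orbT.
- exact: leq_trans costP _.
- apply: leq_ltn_trans costP _.
  (* The vertices [x], [y] and the sets [P], [W] are disjoint and avoid [B]; counting [y] makes the
     bound strict. *)
  have dPW : [disjoint P & W].
    by rewrite disjoint_subset; apply/subsetP => u /PW.
  have : x |: (y |: (P :|: W)) \subset ~: B.
    apply/subsetP => u; rewrite !in_setU1 in_setU in_setC.
    case/or4P=> [/eqP->|/eqP->||] //; last by rewrite inW => /andP[].
    rewrite inP => uP; apply/negP => uB.
    case/orP: uP => /arc/orP[/dj|]; rewrite ?uB //.
      by rewrite (negbTE xB).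
    by rewrite (negbTE yB).
  move/subset_leq_card; apply: leq_trans.
  rewrite cardsU1 cardsU1 cardsU (disjoint_setI0 dPW) cards0 subn0.
  by rewrite in_setU1 !in_setU (negbTE xy) (negbTE xP) (negbTE yP) (negbTE xW) (negbTE yW).
Qed.

(** * OBreaker's invariant and its upkeep *)

(* The alternative [b <= 5 * d + 2] is the phase in which d has stopped growing. *)
Definition good b D : Prop :=
  exists A B r s, biclique_order D A B r s /\
  ((exists d, [/\ #|A| = r + d, #|B| = s + d, b <= #|T|
                & d = r + s \/ b <= 5 * d + 2]) \/
   [/\ A :|: B = setT, #|A| <= b.+1 & #|B| <= b.+1]).

Lemma good_flip b D : good b D -> good b (flip D).
Proof.
case=> A [B [r [s [/biclique_order_flip bo cond]]]].
exists B, A, s, r; split=> //.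
case: cond => [[d [hA hB bT hd]]|[AB hA hB]]; [left|right].
  by exists d; split=> //; rewrite [s + r]addnC.
by split=> //; rewrite setUC.
Qed.

Lemma card_setD_trans D1 D2 D3 :
  #|D3 :\: D1| <= #|D3 :\: D2| + #|D2 :\: D1|.
Proof.
apply: leq_trans (leq_card_setU _ _); apply: subset_leq_card.
apply/subsetP => a; rewrite !inE.
by case: (a \in D1); case: (a \in D2); case: (a \in D3).
Qed.

Lemma card_biclique_order D A B r s :
  biclique_order D A B r s -> #|A| + #|B| = #|A :|: B|.
Proof.
move=> bo; apply/esym/eqP; rewrite leq_card_setU.
by rewrite disjoint_subset; apply/subsetP => u; apply: bo_disj bo u.
Qed.

Lemma biclique_order_add_left D A B r s :
  biclique_order D A B r s -> #|A| + #|B| < #|T| ->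
  exists c D', [/\ c \notin A, biclique_order D' (c |: A) B r s, D \subset D'
                 & #|D' :\: D| <= #|B|].
Proof.
move=> bo; rewrite (card_biclique_order bo) => lt.
have [c cAB] : exists c, c \notin A :|: B.
  apply/existsP; apply: contraLR lt; rewrite negb_exists => /forallP h.
  rewrite -leqNgt -cardsT; apply: subset_leq_card; apply/subsetP => u _.
  by have := h u; rewrite negbK.
move: cAB; rewrite inE negb_or => /andP[cA cB].
have [bo' le] := biclique_order_widen bo cB.
by exists c, (D :|: setX [set c] B); split=> //; apply: subsetUl.
Qed.

Lemma biclique_order_add_right D A B r s :
  biclique_order D A B r s -> #|A| + #|B| < #|T| ->
  exists c D', [/\ c \notin B, biclique_order D' A (c |: B) r s, D \subset D'
                 & #|D' :\: D| <= #|A|].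
Proof.
rewrite addnC => /biclique_order_flip bo /(biclique_order_add_left bo).
case=> [c [D' [cB bo' S le]]].
exists c, (flip D'); split=> //.
- exact: biclique_order_flip bo'.
- by rewrite -[D]flipK; apply: flipS.
- by rewrite -[D]flipK -flipD card_flip.
Qed.

(** As the rank becomes [r.+1], [A] must gain exactly one vertex to keep [#|A| - r] fixed: [x]
    itself if it is not yet in [A], otherwise any free vertex. *)
Lemma biclique_order_add_insert D A B r s x y :
  biclique_order D A B r s -> #|A| + #|B| < #|T| ->
  x \notin B -> y \notin B -> x != y -> (x, y) \notin D -> (y, x) \notin D ->
  exists A' D', [/\ #|A'| = #|A|.+1, biclique_order D' A' B r.+1 s,
    D \subset D', (x, y) \in D' & #|D' :\: D| <= #|B| + r.+1].
Proof.
move=> bo lt xB yB xy xyD yxD.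
have [c [cA cB xc]] : exists c, [/\ c \notin A, c \notin B & x \in c |: A].
  case: (boolP (x \in A)) => xA; last by exists x; rewrite setU11.
  have [c [D' [cA bo' _ _]]] := biclique_order_add_left bo lt.
  exists c; split=> //; last by rewrite inE xA orbT.
  by apply: (bo_disj bo'); rewrite setU11.
have [bo1 le1] := biclique_order_widen bo cB.
have nD1 u v : v \notin B -> (u, v) \notin D -> (u, v) \notin D :|: setX [set c] B.
  by move=> vB uvD; rewrite !inE negb_or uvD negb_and vB orbT.
have [D' [bo2 S2 xyD' le2 _]] :=
  biclique_order_insert bo1 xc yB xy (nD1 _ _ yB xyD) (nD1 _ _ xB yxD).
exists (c |: A), D'; split=> //.
- by rewrite cardsU1 cA.
- exact: subset_trans (subsetUl _ _) S2.
- apply: leq_trans (card_setD_trans _ (D :|: setX [set c] B) _) _.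
  by rewrite addnC leq_add.
Qed.

Lemma good_stepA b D A B r s x y : 5 * #|T| + 7 <= 6 * b ->
  biclique_order D A B r s ->
  ((exists d, [/\ #|A| = r + d, #|B| = s + d, b <= #|T|
                & d = r + s \/ b <= 5 * d + 2]) \/
   [/\ A :|: B = setT, #|A| <= b.+1 & #|B| <= b.+1]) ->
  x \notin B -> y \notin B -> x != y -> (x, y) \notin D -> (y, x) \notin D ->
  exists D', [/\ good b D', D \subset D', (x, y) \in D' & #|D' :\: D| <= b].
Proof.
move=> hb bo cond xB yB xy xyD yxD.
have cAB := card_biclique_order bo.
case: (eqVneq (A :|: B) setT) => [AB|ABn].
  (* If [d = r + s], then [#|T| = 3 * d] and both sets have at most [2 * d] elements; otherwise both
     have at most [#|T| - d], where [5 * d >= b - 2]. *)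
  have [leA leB] : #|A| <= b.+1 /\ #|B| <= b.+1.
    move: cAB; rewrite AB cardsT.
    by case: cond => [[d [hA hB bT hd]]|[]] //; split; lia.
  have xA : x \in A by have := in_setT x; rewrite -AB inE (negbTE xB) orbF.
  have [D' [bo' S' xyD' _ le]] := biclique_order_insert bo xA yB xy xyD yxD.
  exists D'; split=> //.
    by exists A, B, r.+1, s; split=> //; right.
  have := cardsC B; move: cAB le leA; rewrite AB cardsT; clear; lia.
case: cond => [[d [hA hB bT hd]]|[AB]]; last by rewrite AB eqxx in ABn.
have lt : #|A| + #|B| < #|T|.
  by rewrite cAB -cardsT; apply: proper_card; rewrite properT.
have [A' [D' [hA' bo' S' xyD' le]]] := biclique_order_add_insert bo lt xB yB xy xyD yxD.
case: (leqP b (5 * d + 2)) => [bd|bd].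
  (* Since [r + s + 2 * d < #|T|], the cost [s + d + r.+1] is at most [#|T| - d], and
     [5 * d >= b - 2] brings this below [b]. *)
  exists D'; split=> //; last first.
    apply: leq_trans le _; move: hA hB lt bd hb; clear; lia.
  exists A', B, r.+1, s; split=> //; left; exists d; split=> //; last by right.
  by rewrite hA' hA.
have {}hd : d = r + s by move: hd bd; clear; lia.
(* Room for two new vertices in [A] and one in [B]: [3 * d + 3 <= 5 * d + 3 <= b <= #|T|]. *)
have lt3 : #|A| + #|B| + 3 <= #|T| by move: hA hB hd bd bT; clear; lia.
have [|c2 [D2 [c2A bo2 S2 le2]]] := biclique_order_add_left bo'.
  by rewrite hA'; move: lt3; clear; lia.
have hA2 : #|c2 |: A'| = #|A'|.+1 by rewrite cardsU1 c2A.
have [|c3 [D3 [c3B bo3 S3 le3]]] := biclique_order_add_right bo2.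
  by rewrite hA2 hA'; move: lt3; clear; lia.
have hB3 : #|c3 |: B| = #|B|.+1 by rewrite cardsU1 c3B.
exists D3; split.
(* [A] gained two vertices, [B] one, and [r] rose by one, so [d.+1] is again the sum of the
   ranks. *)
- exists (c2 |: A'), (c3 |: B), r.+1, s; split=> //; left; exists d.+1.
  rewrite hA2 hA' hB3 hA hB; split=> //; [| |left];
    by move: hd bd; clear; lia.
- exact: subset_trans S' (subset_trans S2 S3).
- by apply: (subsetP S3); apply: (subsetP S2).
(* The insertion costs [2 * d + 1], [c2] costs [s + d] and [c3] costs [r + d + 2], in total
   [5 * d + 3 <= b]. *)
- apply: leq_trans (card_setD_trans D D2 D3) _.
  apply: leq_trans (leq_add le3 (card_setD_trans D D' D2)) _.
  apply: leq_trans (leq_add (leqnn _) (leq_add le2 le)) _.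
  rewrite hA2 hA'; move: hd hA hB bd; clear; lia.
Qed.

(** All arcs of [A] x [B] are present, so an undirected pair avoids [B] or avoids [A]; the second
    case is the first one after reversal. *)
Lemma good_step b D x y : 5 * #|T| + 7 <= 6 * b -> good b D ->
  x != y -> (x, y) \notin D -> (y, x) \notin D ->
  exists D', [/\ good b D', D \subset D', (x, y) \in D' & #|D' :\: D| <= b].
Proof.
move=> hb gD xy xyD yxD; have := gD; case=> A [B [r [s [bo cond]]]].
case: (boolP ((x \in B) || (y \in B))) => [xyB|]; last first.
  by rewrite negb_or => /andP[xB yB]; apply: (good_stepA hb bo cond).
have [xA yA] : x \notin A /\ y \notin A.
  have nA u v : (u, v) \notin D -> v \in B -> u \notin A.
    by move=> uvD vB; apply: contra uvD => uA; apply: bo_full bo _ _ uA vB.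
  have nB u : u \in B -> u \notin A by move=> uB; apply/negP => /(bo_disj bo); rewrite uB.
  by case/orP: xyB => h; split; [apply: nB | apply: nA h | apply: nA h | apply: nB].
have bo' := biclique_order_flip bo.
have [||||||D' [gD' S le1 le2]] := @good_stepA b (flip D) B A s r y x hb bo';
  rewrite ?in_flip // 1?eq_sym //.
  case: cond => [[d [hA hB bT hd]]|[AB hA hB]]; [left|right].
    by exists d; split=> //; rewrite [s + r]addnC.
  by split=> //; rewrite setUC.
exists (flip D'); split.
- exact: good_flip.
- by rewrite -[D]flipK; apply: flipS.
- by rewrite in_flip.
- by rewrite -[D]flipK -flipD card_flip.
Qed.

Lemma good_start b : 5 * #|T| + 7 <= 6 * b -> good b set0.
Proof.
(* With at most [b.+1] vertices the final phase holds from the start; otherwise [b <= #|T|], as the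
   growing phase requires. *)
move=> hb; case: (leqP #|T| b.+1) => h.
  exists setT, set0, 0, 0; split; first exact: biclique_order_setT.
  by right; rewrite setU0 cardsT cards0.
exists set0, set0, 0, 0; split; first exact: biclique_order0.
by left; exists 0; rewrite !cards0; split=> //; [lia | left].
Qed.

End BicliqueOrder.

(** * From the invariant to a winning strategy and the threshold *)

Section BreakerWins.

Variables (n b : nat).
Hypothesis hb : 5 * n + 7 <= 6 * b.
Implicit Types (D E : position n).

Lemma good_oriented D : good b D -> oriented D.
Proof.
case=> A [B [r [s [bo _]]]]; apply/forallP => u; apply/forallP => v.
apply/implyP => uv; apply/negP => vu.
by have := bo_irr bo u; rewrite (bo_trans bo uv vu).
Qed.

(** Subpositions matter because after OMaker's arc only an extension of the position is known to be
    good. *)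
Lemma good_acyclic D E : good b E -> D \subset E -> ~ has_dicycle D.
Proof.
case=> A [B [r [s [bo _]]]] /subsetP S [[|x c] [// _ /andP[cy _]]].
have {}cy : path (Defs.arc E) x (rcons c x) by apply: sub_path cy => u v; apply: S.
have tr : transitive (Defs.arc E) by move=> v u w; apply: bo_trans bo v u w.
have /allP/(_ x) := order_path_min tr cy.
rewrite mem_rcons mem_head /Defs.arc => /(_ isT).
by rewrite (negbTE (bo_irr bo x)).
Qed.

Lemma good_extend D x y : good b D -> x != y -> (x, y) \notin D -> (y, x) \notin D ->
  exists D', [/\ good b D', D \subset D', (x, y) \in D' & #|D' :\: D| <= b].
Proof. by apply: good_step; rewrite card_ord. Qed.

(* After OMaker's arc a good position may already be reached for free; since
   OBreaker has to move, he then absorbs an arc of his own choice. This is why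
   absorbing an arc is allowed to cost b rather than b + 1. *)
Lemma value_good k :
  (forall D, good b D -> value b OBreaker k OMaker D) /\
  (forall E D, good b D -> E \subset D -> #|D :\: E| < b ->
     value b OBreaker k OBreaker E).
Proof.
have openP D : oriented D -> ~~ tournament D ->
    exists x y, [/\ x != y, (x, y) \notin D & (y, x) \notin D].
  rewrite /tournament => -> /=; rewrite negb_forall => /existsP[x].
  rewrite negb_forall => /existsP[y]; rewrite negb_imply negb_or => /and3P[? ? ?].
  by exists x, y.
elim: k => [|k [IHM IHB]].
  split=> [D gD|E D gD ED _]; apply/asboolP; last exact: good_acyclic gD ED.
  exact: good_acyclic gD (subxx _).
split=> [D gD|E D gD ED lt] /=; case: ifP => [_|/negbT T].
- by apply/asboolP; apply: good_acyclic gD (subxx _).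
- apply/forallP => E; apply/implyP => /and3P[oE sDE]; rewrite -eqn_leq eq_sym.
  case/cards1P => -[x y] e.
  have : (x, y) \in E :\: D by rewrite e set11.
  rewrite inE => /andP[xyD xyE].
  have yxE : (y, x) \notin E by move/forallP/(_ x)/forallP/(_ y)/implyP: oE; apply.
  have yxD : (y, x) \notin D by apply: contra yxE => /(subsetP sDE).
  have xy : x != y by apply: contraNneq yxE => xy; rewrite xy in xyE *.
  have [D' [gD' sDD' xyD' le]] := good_extend gD xy xyD yxD.
  have ED' : E \subset D'.
    by rewrite -(setID E D) (setIidPr sDE) e subUset sDD' sub1set.
  (* OMaker's own arc is one of the at most [b] new arcs, so fewer than [b] remain for OBreaker. *)
  apply: IHB gD' ED' _; apply: leq_trans le.
  apply: proper_card; apply/properP; split; first exact: setDS.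
  by exists (x, y); rewrite inE ?xyE ?xyD.
- by apply/asboolP; apply: good_acyclic gD ED.
- apply/existsP; case: (eqVneq E D) => [eED|nED].
    have oE : oriented E by rewrite eED; apply: good_oriented.
    have [x [y [xy xyE yxE]]] := openP E oE T.
    rewrite eED in T xyE yxE *.
    have [D' [gD' sDD' xyD' le]] := good_extend gD xy xyE yxE.
    exists D'; rewrite /move (good_oriented gD') sDD' le IHM // !andbT /=.
    by apply/card_gt0P; exists (x, y); rewrite inE xyE.
  exists D; rewrite /move (good_oriented gD) ED (ltnW lt) IHM // !andbT /=.
  rewrite card_gt0 setD_eq0; apply: contra nED => DE.
  by rewrite eqEsubset ED DE.
Qed.

Lemma breaker_wins : has_winning_strategy n b OBreaker.
Proof.
apply: value_win; apply: (value_good _).1; apply: good_start.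
by rewrite card_ord.
Qed.

End BreakerWins.

Theorem theorem1p2 (n : nat) (hn : 3 <= n) :
  ((threshold n)%:R <= 5%:R * n%:R / 6%:R + 1 :> rat)%R.
Proof.
(* Otherwise OBreaker wins at bias [threshold n], where OMaker wins by definition. *)
have : 6 * threshold n <= 5 * n + 6.
  rewrite leqNgt; apply/negP => lt.
  have t0 : 0 < threshold n by lia.
  apply: (not_both_win ((@thresholdP n _ t0).1 (leqnn _))).
  by apply: breaker_wins; lia.
rewrite -(Num.Theory.ler_nat rat) GRing.natrD !GRing.natrM; lra.
Qed.
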